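(* Let $n\ge 1$ and let $\alpha_1\ge\dots\ge\alpha_n\ge 0$ be ordinals, and $X=\omega^{\alpha_1}\times\dots\times\omega^{\alpha_n}$. If $\alpha_2=\dots=\alpha_n=0$ (in particular if $n=1$), then $\mathbf{w}(X)=1$; otherwise $\mathbf{w}(X)=\omega^{\alpha_1\oplus((\alpha_2\oplus\dots\oplus\alpha_n)-1)}$.
   Context: $X$ has the componentwise order. The width $\mathbf{w}(A)$ of a wqo $A$ is the rank of the forest of nonempty finite sequences of pairwise incomparable elements of $A$ ordered by initial segment. $\oplus$ is the natural (Hessenberg) sum. For ordinals $\beta\le\gamma$, $\gamma-\beta$ denotes the unique $\delta$ with $\beta+\delta=\gamma$. *)

(* Defs.v *)
From mathcomp Require Import all_boot.

Set Implicit Arguments.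
Unset Strict Implicit.
Unset Printing Implicit Defensive.

Inductive Ord : Type :=
| OZ : Ord
| OS : Ord -> Ord
| OL : forall (J : Type), (J -> Ord) -> Ord.   (* supremum of a family *)

(** canonical "predecessor" type of a tree: its elements name (with
    repetitions) all ordinals strictly below it *)
Fixpoint pd (a : Ord) : Type :=
  match a with
  | OZ => Empty_set
  | OS b => option (pd b)
  | OL J f => sigT (fun i : J => pd (f i))
  end.

Fixpoint pval (a : Ord) : pd a -> Ord :=
  match a return pd a -> Ord with
  | OZ => fun e => match e with end
  | OS b => fun o => match o with None => b | Some p => pval p end
  | OL J f => fun x => pval (projT2 x)
  end.

Fixpoint ole (a b : Ord) : Prop :=
  match a with
  | OZ => True
  | OS a' => exists p : pd b, ole a' (pval p)
  | OL J f => forall i, ole (f i) b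
  end.

Definition olt (a b : Ord) : Prop := ole (OS a) b.
Definition oeq (a b : Ord) : Prop := ole a b /\ ole b a.

Definition oone : Ord := OS OZ.

Fixpoint oadd (a b : Ord) : Ord :=
  match b with
  | OZ => a
  | OS b' => OS (oadd a b')
  | OL J f => OL (fun o : option J =>
                   match o with None => a | Some i => oadd a (f i) end)
  end.

Fixpoint omul_nat (x : Ord) (n : nat) : Ord :=
  match n with
  | 0 => OZ
  | k.+1 => oadd (omul_nat x k) x
  end.

Fixpoint oexpw (a : Ord) : Ord :=
  match a with
  | OZ => oone
  | OS b => OL (fun n : nat => omul_nat (oexpw b) n)
  | OL J f => OL (fun o : option J =>
                   match o with None => oone | Some i => oexpw (f i) end)
  end.

Definition osub (y a : Ord) : Prop := exists p : pd a, y = pval p.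

Lemma osub_acc_pd (a : Ord) : forall p : pd a, Acc osub (pval p).
Proof.
elim: a => [|b IH|J f IH] /=.
- by case.
- case=> [p|]; first exact: IH.
  by constructor=> y [p ->]; apply: IH.
- by case=> i p; apply: IH.
Qed.

Lemma osub_wf : well_founded osub.
Proof. by move=> a; constructor=> y [p ->]; apply: osub_acc_pd. Qed.

(** natural (Hessenberg) sum:
    a (+) b = sup { (a' (+) b) + 1, (a (+) b') + 1 : a' < a, b' < b } *)
Definition onsum : Ord -> Ord -> Ord :=
  Fix osub_wf (fun _ => Ord -> Ord)
    (fun a recA =>
       Fix osub_wf (fun _ => Ord)
         (fun b recB =>
            OL (fun s : pd a + pd b =>
                  match s with
                  | inl p => OS (recA (pval p) (ex_intro _ p erefl) b)
                  | inr q => OS (recB (pval q) (ex_intro _ q erefl))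
                  end))).

Section Width.
Variables (T : Type) (le : T -> T -> Prop).

Definition incomp (x y : T) : Prop := ~ le x y /\ ~ le y x.

Fixpoint all_incomp (x : T) (s : seq T) : Prop :=
  match s with
  | [::] => True
  | y :: s' => incomp x y /\ all_incomp x s'
  end.

Fixpoint antichain (s : seq T) : Prop :=
  match s with
  | [::] => True
  | x :: s' => all_incomp x s' /\ antichain s'
  end.

Definition anode : Type := {s : seq T | s <> [::] /\ antichain s}.

Definition aext (s t : anode) : Prop :=
  exists u : seq T, u <> [::] /\ proj1_sig t = proj1_sig s ++ u.

(** [width_is g] : the rank of the forest of antichain sequences is g.
    rho is the rank function (rho s = sup {rho t + 1 | t extends s}) and
    the rank of the forest is sup {rho s + 1 | s node}. *)
Definition width_is (g : Ord) : Prop :=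
  exists rho : anode -> Ord,
    (forall s : anode,
        oeq (rho s) (OL (fun t : {t : anode | aext s t} => OS (rho (proj1_sig t)))))
    /\ oeq g (OL (fun s : anode => OS (rho s))).

End Width.

(** The product omega^(alpha 0) x ... x omega^(alpha (n-1)) with the
    componentwise order; the factor omega^a is represented by pd (oexpw a)
    quasi-ordered by the value of its elements. *)
Definition prodX (n : nat) (alpha : 'I_n -> Ord) : Type :=
  forall i : 'I_n, pd (oexpw (alpha i)).

Definition prodX_le (n : nat) (alpha : 'I_n -> Ord) (x y : prodX alpha) : Prop :=
  forall i : 'I_n, ole (pval (x i)) (pval (y i)).

(* Main.v *)
Require Import Defs.
From mathcomp Require Import all_boot.
From Stdlib Require Import Classical FunctionalExtensionality List.

Set Implicit Arguments.
Unset Strict Implicit.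
Unset Printing Implicit Defensive.

(** The width of a subset P is the supremum over x in P of the width of the residual
    {y in P | y incomparable to x}, plus one.  Write S_m for the natural sum of the exponents other
    than alpha_m, and X[i := b] for the product with alpha_i replaced by b.

    Upper bound: w(X) <= w^(alpha_m (+) d) for every m with S_m <= 1 + d.  The residual at x is
    covered by the sets {y | y_i < x_i}, each a finite union of copies of products X[i := b] with
    b < alpha_i, whose exponents are strictly smaller; widths of unions are bounded by natural sums,
    and w^g is closed under these.

    Lower bound: if b < alpha_i and some other exponent alpha_j is positive, then
    w(X) >= w(X[i := b]) * k for every k.  Hence one may add 1 to the exponent of w(X[i := b]), and an
    induction gives w^(alpha_m (+) e) <= w(X) for e < S_m.  This settles the case of finite S_1, where
    S_1 - 1 < S_1.  If S_1 is infinite, two of the alpha_i are infinite, and then w^T <= w(X) for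
    the natural sum T of all the exponents: when X[i := b] no longer has two infinite exponents,
    b + 1 < alpha_i leaves room to reach T[i := b] through X[i := b + 1]. *)

(** * The order on ordinal notations *)

Lemma ole_OL a (J : Type) (f : J -> Ord) i : ole a (f i) -> ole a (OL f).
Proof.
elim: a => [|a IH|K g IH] //=; first by case=> p hp; exists (existT _ i p).
by move=> h k; apply: IH.
Qed.

Lemma ole_refl a : ole a a.
Proof.
elim: a => [|a IH|J f IH] //=; first by exists None.
by move=> i; apply: (ole_OL (i := i)).
Qed.

(** Transitivity of the predecessor relation, here with syntactic equality of values and not merely
    [oeq]. *)
Lemma pd_pval c (q : pd c) (r : pd (pval q)) : exists s : pd c, pval s = pval r.
Proof.
elim: c q r => [|c IH|J f IH] /=; first by case.
- case=> [q|] r; last by exists (Some r).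
  by have [s es] := IH q r; exists (Some s).
- by case=> i q r; have [s es] := IH i q r; exists (existT _ i s).
Qed.

Lemma ole_pd b c (p : pd b) : ole b c -> olt (pval p) c.
Proof.
elim: b c p => [|b IH|J f IH] c /=; first by case.
- move=> [p|] [q hq]; last by exists q.
  have [r hr] := IH _ p hq; have [s es] := pd_pval r.
  by exists s; rewrite es.
- by case=> i p h; apply: IH.
Qed.

Lemma ole_trans b a c : ole a b -> ole b c -> ole a c.
Proof.
elim: a b c => [|a IH|J f IH] b c //=.
- case=> p hp hbc; have [q hq] := ole_pd p hbc.
  by exists q; apply: IH hq.
- by move=> h hbc i; apply: IH hbc.
Qed.

Lemma olt_pval a (p : pd a) : olt (pval p) a.
Proof. exact: (ole_pd p (ole_refl a)). Qed.

Lemma olt_OS a : olt a (OS a).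
Proof. exact: ole_refl. Qed.

Lemma ole_OS a : ole a (OS a).
Proof.
elim: a => [|a IH|J f IH] //=; first by exists None.
move=> i; apply: ole_trans (IH i) _.
by exists None; apply: (ole_OL (i := i)); apply: ole_refl.
Qed.

Lemma oltW a b : olt a b -> ole a b.
Proof. by move=> h; apply: ole_trans (ole_OS a) h. Qed.

Lemma ole_lt_trans b a c : ole a b -> olt b c -> olt a c.
Proof. by move=> hab [p hp]; exists p; apply: ole_trans hp. Qed.

Lemma olt_le_trans b a c : olt a b -> ole b c -> olt a c.
Proof. exact: ole_trans. Qed.

(** Well-foundedness of [osub] covers only literal predecessors [pval p]; quantifying over all [b]
    below [a] extends it to everything at or below one of them. *)
Lemma olt_wf : well_founded olt.
Proof.
suff H a : forall b, ole b a -> Acc olt b by move=> a; apply: H (ole_refl a).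
elim/(well_founded_ind osub_wf): a => a IH b hb; constructor=> c hc.
have [p hp] := olt_le_trans hc hb.
by apply: (IH (pval p)) hp; exists p.
Qed.

Lemma olt_irr a : ~ olt a a.
Proof. by elim/(well_founded_ind olt_wf): a => a IH h; apply: (IH a). Qed.

Lemma olt_leF a b : olt a b -> ~ ole b a.
Proof. by move=> h1 h2; apply: (@olt_irr a); apply: olt_le_trans h2. Qed.

Lemma ole_pval b c : (forall p : pd b, olt (pval p) c) -> ole b c.
Proof.
elim: b => [|b IH|J f IH] //= h; first exact: (h None).
by move=> i; apply: IH => p; apply: (h (existT _ i p)).
Qed.

Lemma ole_or_lt a b : ole a b \/ olt b a.
Proof.
elim: a b => [|a IH|J f IH] b; first by left.
- have [[p hp]|h] := classic (exists p : pd b, ole a (pval p)).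
    by left; exists p.
  right; exists None; apply: ole_pval => p /=.
  by have [h1|//] := IH (pval p); case: h; exists p.
- have [h|h] := classic (forall i, ole (f i) b); first by left.
  have [i hi] := not_all_ex_not _ _ h; right.
  have [//|[p hp]] := IH i b.
  by exists (existT _ i p).
Qed.

Lemma ole_nlt a b : ~ olt b a -> ole a b.
Proof. by have [|h /(_ h)] := ole_or_lt a b. Qed.

Lemma olt_nle a b : ~ ole b a -> olt a b.
Proof. by have [h /(_ h)|] := ole_or_lt b a. Qed.

Lemma ole_lt b c : (forall a, olt a b -> olt a c) -> ole b c.
Proof. by move=> h; apply: ole_nlt => /h; apply: olt_irr. Qed.

Lemma oeq_refl a : oeq a a.
Proof. by split; apply: ole_refl. Qed.

Lemma oeq_sym a b : oeq a b -> oeq b a.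
Proof. by case. Qed.

Lemma oeq_trans b a c : oeq a b -> oeq b c -> oeq a c.
Proof. by move=> [? ?] [? ?]; split; apply: (@ole_trans b). Qed.

Lemma olt_OL c (J : Type) (f : J -> Ord) : olt c (OL f) -> exists i, olt c (f i).
Proof. by case=> -[i p] hp; exists i, p. Qed.

Lemma ole_OS_OS a b : ole a b -> ole (OS a) (OS b).
Proof. by exists None. Qed.

Lemma olt_OS_le a b : olt a (OS b) -> ole a b.
Proof.
by move=> h; apply: ole_nlt => hb; apply: (@olt_irr (OS b)); apply: ole_lt_trans h.
Qed.

(** * Ordinal addition and powers of omega *)

Lemma ole_oaddr a b : ole a (oadd a b).
Proof.
elim: b => [|b IH|J f IH] /=; first exact: ole_refl.
  by apply: ole_trans IH _; apply: ole_OS.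
by apply: (ole_OL (i := None)); apply: ole_refl.
Qed.

Lemma olt_oadd_pval a b (p : pd b) : olt (oadd a (pval p)) (oadd a b).
Proof.
elim: b p => [|b IH|J f IH] /=; first by case.
- case=> [p|]; last exact: olt_OS.
  by apply: olt_le_trans (IH p) _; apply: ole_OS.
- by case=> i p; apply: (ole_OL (i := Some i)); apply: IH.
Qed.

Lemma ole_oadd2l a b b' : ole b b' -> ole (oadd a b) (oadd a b').
Proof.
elim: b b' => [|b IH|J f IH] b' h; first exact: ole_oaddr.
- case: h => p /IH hp; exact: ole_lt_trans hp (olt_oadd_pval a p).
- by case=> [i|] /=; [apply: IH; apply: h | apply: ole_oaddr].
Qed.

Lemma olt_oadd2l a b b' : olt b b' -> olt (oadd a b) (oadd a b').
Proof. exact: (@ole_oadd2l a (OS b)). Qed.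

Lemma ole_oadd2lE a b b' : ole (oadd a b) (oadd a b') -> ole b b'.
Proof. by move=> h; apply: ole_nlt => /(@olt_oadd2l a) /olt_leF. Qed.

Lemma ole_oadd2r a a' b : ole a a' -> ole (oadd a b) (oadd a' b).
Proof.
move=> h; elim: b => [|b IH|J f IH] //=; first exact: ole_OS_OS.
case=> [i|]; first by apply: (ole_OL (i := Some i)).
exact: (ole_OL (i := None)).
Qed.

Lemma ole_oaddl a b : ole b (oadd a b).
Proof.
elim: b => [|b IH|J f IH] //=; first exact: ole_OS_OS.
by move=> i; apply: (ole_OL (i := Some i)).
Qed.

Lemma olt_oadd_inv c a b :
  olt c (oadd a b) -> olt c a \/ exists2 b', olt b' b & oeq c (oadd a b').
Proof.
elim: b => [|b IH|J f IH] h; first by left.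
- have h1 := olt_OS_le h.
  have [h2|h2] := ole_or_lt (oadd a b) c.
    by right; exists b => //; apply: olt_OS.
  have [?|[b' hb' e]] := IH h2; first by left.
  by right; exists b' => //; apply: olt_le_trans (ole_OS b).
- have [[i|] hi] := olt_OL h; last by left.
  have [?|[b' hb' e]] := IH i hi; first by left.
  right; exists b' => //; exact: (ole_OL (i := i)).
Qed.

Lemma oexpw_ge1 a : ole oone (oexpw a).
Proof.
elim: a => [|a IH|J f IH]; first exact: ole_refl.
- apply: (ole_OL (i := 1)) => /=; apply: ole_trans IH _; exact: ole_oaddl.
- by apply: (ole_OL (i := None)); apply: ole_refl.
Qed.

Lemma oexpw_pval g (p : pd g) : ole (oexpw (OS (pval p))) (oexpw g).
Proof.
elim: g p => [|g IH|J f IH]; first by case.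
- case=> [p|]; last exact: ole_refl.
  apply: ole_trans (IH p) _; apply: (ole_OL (i := 1)); exact: ole_oaddl.
- by case=> i p; apply: ole_trans (IH i p) _; apply: (ole_OL (i := Some i)); apply: ole_refl.
Qed.

Lemma omul_nat_mono x y k : ole x y -> ole (omul_nat x k) (omul_nat y k).
Proof.
move=> h; elim: k => //= k IH.
exact: ole_trans (ole_oadd2r x IH) (ole_oadd2l _ h).
Qed.

Lemma omul_nat_le x k l : k <= l -> ole (omul_nat x k) (omul_nat x l).
Proof.
elim: l => [|l IH]; first by rewrite leqn0 => /eqP ->.
rewrite leq_eqVlt => /orP[/eqP ->|]; first exact: ole_refl.
by rewrite ltnS => /IH h; apply: ole_trans h _; apply: ole_oaddr.
Qed.

Lemma oexpw_mono a b : ole a b -> ole (oexpw a) (oexpw b).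
Proof.
elim: a b => [|a IH|J f IH] b h; first exact: oexpw_ge1.
- case: h => p hp; apply: ole_trans (oexpw_pval p) => k /=.
  by apply: (ole_OL (i := k)); apply: omul_nat_mono; apply: IH.
- by case=> [i|]; [apply: IH; apply: h | apply: oexpw_ge1].
Qed.

Lemma omul_nat_lt x k : olt OZ x -> olt (omul_nat x k) (omul_nat x k.+1).
Proof. exact: (@olt_oadd2l _ OZ x). Qed.

Lemma omul_oexpw_lt b g k : olt b g -> olt (omul_nat (oexpw b) k) (oexpw g).
Proof.
move=> h; apply: (@olt_le_trans (omul_nat (oexpw b) k.+1)).
  by apply: omul_nat_lt; apply: oexpw_ge1.
apply: ole_trans (oexpw_mono h); exact: (ole_OL (i := k.+1) (ole_refl _)).
Qed.

Lemma oexpw_lt b g : olt b g -> olt (oexpw b) (oexpw g).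
Proof. by move/(@omul_oexpw_lt _ _ 1); apply: ole_lt_trans; apply: ole_oaddl. Qed.

(** Stand-in for the Cantor normal form: a nonzero ordinal below w^g lies below a finite multiple of
    a smaller power. *)
Lemma olt_oexpw_inv c g :
  olt c (oexpw g) -> ole c OZ \/ exists b k, olt b g /\ olt c (omul_nat (oexpw b) k).
Proof.
elim: g => [|g IH|J f IH] h.
- by left; apply: olt_OS_le h.
- have [k hk] := olt_OL h.
  by right; exists g, k; split=> //; apply: olt_OS.
- have [[i|] hi] := olt_OL h; last by left; apply: olt_OS_le hi.
  have [?|[b [k [hb hc]]]] := IH i hi; first by left.
  right; exists b, k; split=> //; exact: (ole_OL (i := i)).
Qed.

Lemma olt_omul_inv c x k : olt c (omul_nat x k) ->
  exists l r, [/\ l < k, olt r x & oeq c (oadd (omul_nat x l) r)].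
Proof.
elim: k => [|k IH]; first by case=> -[].
case/olt_oadd_inv => [/IH [l [r [hl hr e]]]|[r hr e]].
  by exists l, r; split=> //; apply: leqW.
by exists k, r.
Qed.

(** * Natural sums and the indecomposability of powers of omega *)

(** Unfolds the two nested uses of [Fix]; each [Fix_eq] asks that the functional be extensional. *)
Lemma onsumE a b : onsum a b = OL (fun s : pd a + pd b =>
  match s with
  | inl p => OS (onsum (pval p) b)
  | inr q => OS (onsum a (pval q))
  end).
Proof.
rewrite {1}/onsum Fix_eq; last first.
  move=> x f g efg; congr Fix.
  apply: functional_extensionality_dep => b'.
  apply: functional_extensionality_dep => rec.
  by congr OL; apply: functional_extensionality_dep => -[p|q] //; rewrite efg.
rewrite Fix_eq; last first.
  move=> x f g efg.
  by congr OL; apply: functional_extensionality_dep => -[p|q] //; rewrite efg.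
congr OL; apply: functional_extensionality_dep => -[p|q] //.
congr OS; rewrite /onsum [in RHS]Fix_eq //.
move=> x f g efg; congr Fix.
apply: functional_extensionality_dep => b'.
apply: functional_extensionality_dep => rec.
by congr OL; apply: functional_extensionality_dep => -[r|r] //; rewrite efg.
Qed.

Lemma olt_onsum_inv c a b : olt c (onsum a b) ->
  (exists2 a', olt a' a & ole c (onsum a' b)) \/
  (exists2 b', olt b' b & ole c (onsum a b')).
Proof.
rewrite onsumE => /olt_OL [[p|q] /olt_OS_le h]; [left|right].
  by exists (pval p) => //; apply: olt_pval.
by exists (pval q) => //; apply: olt_pval.
Qed.

Lemma onsum_le a b z :
  (forall a', olt a' a -> olt (onsum a' b) z) ->
  (forall b', olt b' b -> olt (onsum a b') z) -> ole (onsum a b) z.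
Proof.
by move=> ha hb; rewrite onsumE; case=> p; [apply: ha | apply: hb]; apply: olt_pval.
Qed.

Lemma onsum_mono a a' b b' : ole a a' -> ole b b' -> ole (onsum a b) (onsum a' b').
Proof.
move: b a' b'; elim/(well_founded_ind olt_wf): a => a IHa.
elim/(well_founded_ind olt_wf) => b IHb a' b' ha hb.
apply: onsum_le => x hx; rewrite [onsum a' b']onsumE.
- case: (olt_le_trans hx ha) => p hp.
  by apply: (ole_OL (i := inl p)); apply: ole_OS_OS; apply: IHa.
- case: (olt_le_trans hx hb) => p hp.
  by apply: (ole_OL (i := inr p)); apply: ole_OS_OS; apply: IHb.
Qed.

Lemma onsum_lt2r a a' b : olt a a' -> olt (onsum a b) (onsum a' b).
Proof.
case=> p hp; rewrite [onsum a' b]onsumE; apply: (ole_OL (i := inl p)).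
by apply: ole_OS_OS; apply: onsum_mono => //; apply: ole_refl.
Qed.

Lemma onsum_lt2l a b b' : olt b b' -> olt (onsum a b) (onsum a b').
Proof.
case=> p hp; rewrite [onsum a b']onsumE; apply: (ole_OL (i := inr p)).
by apply: ole_OS_OS; apply: onsum_mono => //; apply: ole_refl.
Qed.

Lemma onsum_eq a a' b b' : oeq a a' -> oeq b b' -> oeq (onsum a b) (onsum a' b').
Proof. by move=> [? ?] [? ?]; split; apply: onsum_mono. Qed.

Lemma onsumC_le a b : ole (onsum a b) (onsum b a).
Proof.
move: b; elim/(well_founded_ind olt_wf): a => a IHa.
elim/(well_founded_ind olt_wf) => b IHb.
apply: onsum_le => x hx.
- by apply: ole_lt_trans (IHa _ hx b) _; apply: onsum_lt2l.
- by apply: ole_lt_trans (IHb _ hx) _; apply: onsum_lt2r.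
Qed.

Lemma onsumC a b : oeq (onsum a b) (onsum b a).
Proof. by split; apply: onsumC_le. Qed.

Lemma onsumA_le a b c : ole (onsum (onsum a b) c) (onsum a (onsum b c)).
Proof.
move: b c; elim/(well_founded_ind olt_wf): a => a IHa.
elim/(well_founded_ind olt_wf) => b IHb.
elim/(well_founded_ind olt_wf) => c IHc.
apply: onsum_le => x hx.
- case: (olt_onsum_inv hx) => -[y hy hxy].
  + apply: (@ole_lt_trans (onsum (onsum y b) c)).
      by apply: onsum_mono => //; apply: ole_refl.
    by apply: ole_lt_trans (IHa _ hy b c) _; apply: onsum_lt2r.
  + apply: (@ole_lt_trans (onsum (onsum a y) c)).
      by apply: onsum_mono => //; apply: ole_refl.
    by apply: ole_lt_trans (IHb _ hy c) _; do 2?[apply: onsum_lt2l || apply: onsum_lt2r].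
- by apply: ole_lt_trans (IHc _ hx) _; do 2!apply: onsum_lt2l.
Qed.

Lemma onsumA a b c : oeq (onsum (onsum a b) c) (onsum a (onsum b c)).
Proof.
split; first exact: onsumA_le.
apply: ole_trans (onsumC_le _ _) _.
apply: ole_trans (onsum_mono (onsumC_le _ _) (ole_refl _)) _.
apply: ole_trans (onsumA_le _ _ _) _.
apply: ole_trans (onsumC_le _ _) _.
exact: onsum_mono (onsumC_le _ _) (ole_refl _).
Qed.

Lemma onsumCA a b c : oeq (onsum a (onsum b c)) (onsum b (onsum a c)).
Proof.
apply: oeq_trans (oeq_sym (onsumA a b c)) _.
apply: oeq_trans (onsum_eq (onsumC _ _) (oeq_refl _)) _; exact: onsumA.
Qed.

Lemma onsumx0 a : oeq (onsum a OZ) a.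
Proof.
elim/(well_founded_ind olt_wf): a => a IH; split.
  apply: onsum_le => x; last by case=> -[].
  by move=> hx; exact: ole_lt_trans (proj1 (IH _ hx)) (hx).
apply: ole_lt => x hx; apply: (@ole_lt_trans (onsum x OZ)).
  by case: (IH _ hx).
exact: onsum_lt2r.
Qed.

Lemma onsum0x a : oeq (onsum OZ a) a.
Proof. exact: oeq_trans (onsumC _ _) (onsumx0 a). Qed.

Lemma ole_onsuml a b : ole a (onsum a b).
Proof. by apply: ole_trans (onsum_mono (ole_refl a) (_ : ole OZ b)) => //; case: (onsumx0 a). Qed.

Lemma ole_onsumr a b : ole b (onsum a b).
Proof. exact: ole_trans (ole_onsuml b a) (onsumC_le b a). Qed.

Lemma oadd_le_onsum a b : ole (oadd a b) (onsum a b).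
Proof.
elim/(well_founded_ind olt_wf): b => b IH; apply: ole_lt => c.
case/olt_oadd_inv => [h|[b' hb' [h _]]].
  exact: olt_le_trans h (ole_onsuml _ _).
apply: ole_lt_trans h _; apply: ole_lt_trans (IH _ hb') _; exact: onsum_lt2l.
Qed.

Definition nsum_closed g := forall a b, olt a g -> olt b g -> olt (onsum a b) g.

(** Quotients and remainders by [g] add separately. A smaller argument either loses a whole block,
    and closedness keeps the sum of the new remainders below [g], or keeps its quotient and lowers
    its remainder. *)
Lemma onsum_blocks g k l r t : nsum_closed g -> olt r g -> olt t g ->
  ole (onsum (oadd (omul_nat g k) r) (oadd (omul_nat g l) t))
      (oadd (omul_nat g (k + l)) (onsum r t)).
Proof.
move=> hg.
(* The bound [z] on the natural sum is the induction measure, while all four parameters vary. *)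
suff H z : forall k l r t, ole (onsum (oadd (omul_nat g k) r) (oadd (omul_nat g l) t)) z ->
    olt r g -> olt t g ->
  ole (onsum (oadd (omul_nat g k) r) (oadd (omul_nat g l) t))
      (oadd (omul_nat g (k + l)) (onsum r t)).
  exact: H (ole_refl _).
elim/(well_founded_ind olt_wf): z => z IH {}k {}l {}r {}t hz hr ht.
apply: onsum_le => x hx.
- have hxz := olt_le_trans (onsum_lt2r (oadd (omul_nat g l) t) hx) hz.
  case: (olt_oadd_inv hx) => [hx'|[r' hr' e]].
  + have [k' [r' [hk hr' e]]] := olt_omul_inv hx'.
    have [e1 e2] := onsum_eq e (oeq_refl (oadd (omul_nat g l) t)).
    apply: ole_lt_trans e1 _.
    apply: ole_lt_trans (IH _ hxz k' l r' t e2 hr' ht) _.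
    apply: olt_le_trans (olt_oadd2l _ (hg _ _ hr' ht)) _.
    apply: ole_trans (ole_oaddr _ _).
    by apply: (@omul_nat_le _ (k' + l).+1); rewrite ltn_add2r.
  + have [e1 e2] := onsum_eq e (oeq_refl (oadd (omul_nat g l) t)).
    apply: ole_lt_trans e1 _.
    apply: ole_lt_trans (IH _ hxz k l r' t e2 (olt_le_trans hr' (oltW hr)) ht) _.
    by apply: olt_oadd2l; apply: onsum_lt2r.
- have hxz := olt_le_trans (onsum_lt2l (oadd (omul_nat g k) r) hx) hz.
  case: (olt_oadd_inv hx) => [hx'|[r' hr' e]].
  + have [k' [r' [hk hr' e]]] := olt_omul_inv hx'.
    have [e1 e2] := onsum_eq (oeq_refl (oadd (omul_nat g k) r)) e.
    apply: ole_lt_trans e1 _.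
    apply: ole_lt_trans (IH _ hxz k k' r r' e2 hr hr') _.
    apply: olt_le_trans (olt_oadd2l _ (hg _ _ hr hr')) _.
    apply: ole_trans (ole_oaddr _ _).
    by apply: (@omul_nat_le _ (k + k').+1); rewrite ltn_add2l.
  + have [e1 e2] := onsum_eq (oeq_refl (oadd (omul_nat g k) r)) e.
    apply: ole_lt_trans e1 _.
    apply: ole_lt_trans (IH _ hxz k l r r' e2 hr (olt_le_trans hr' (oltW ht))) _.
    by apply: olt_oadd2l; apply: onsum_lt2l.
Qed.

(** Nonzero arguments lie below finite multiples of one power w^z with z < g, and [onsum_blocks]
    adds these multiples. *)
Lemma nsum_closed_oexpw g : nsum_closed (oexpw g).
Proof.
elim/(well_founded_ind olt_wf): g => g IH a b ha hb.
have [a0|[x [k [hx hak]]]] := olt_oexpw_inv ha.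
  apply: ole_lt_trans hb; apply: ole_trans (onsum_mono a0 (ole_refl b)) _.
  by case: (onsum0x b).
have [b0|[y [l [hy hbl]]]] := olt_oexpw_inv hb.
  apply: ole_lt_trans ha; apply: ole_trans (onsum_mono (ole_refl a) b0) _.
  by case: (onsumx0 a).
have [z [hz hak' hbl']] : exists z, [/\ olt z g, olt a (omul_nat (oexpw z) k) &
    olt b (omul_nat (oexpw z) l)].
  have [hxy|/oltW hxy] := ole_or_lt x y.
    exists y; split=> //; apply: olt_le_trans hak _.
    by apply: omul_nat_mono; apply: oexpw_mono.
  exists x; split=> //; apply: olt_le_trans hbl _.
  by apply: omul_nat_mono; apply: oexpw_mono.
have h0 : olt OZ (oexpw z) by apply: oexpw_ge1.
have h := @onsum_blocks _ k l _ _ (IH z hz) h0 h0.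
apply: ole_lt_trans (onsum_mono (oltW hak') (oltW hbl')) _.
apply: ole_lt_trans h _.
apply: ole_lt_trans (omul_oexpw_lt (k + l) hz).
by apply: (@ole_oadd2l _ _ OZ); case: (onsumx0 OZ).
Qed.

Lemma oadd_lt_oexpw g a b :
  olt a (oexpw g) -> olt b (oexpw g) -> olt (oadd a b) (oexpw g).
Proof.
by move=> ha hb; apply: ole_lt_trans (oadd_le_onsum a b) _; apply: nsum_closed_oexpw.
Qed.

(** * Widths of subsets *)

Section SubsetWidth.
Variables (T : Type) (le : T -> T -> Prop).

(* A copy of [incomp] whose carrier lives in a universe of its own: that of [incomp] is bounded
   by the index universe of [Ord], which excludes carriers built from [Ord] itself. *)
Definition incmp (x y : T) : Prop := ~ le x y /\ ~ le y x.

Definition incomp_with (s : list T) (y : T) : Prop := forall z, In z s -> incmp z y.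

(** [wle] and [wge] bound the width from above and below without a rank function, so that each can
    be proved by induction; [width_isI] recovers the rank. *)
Inductive wle (P : T -> Prop) (g : Ord) : Prop :=
  WLe of forall x, P x ->
    exists g', olt g' g /\ wle (fun y => P y /\ incmp x y) g'.

Fixpoint wge (P : T -> Prop) (g : Ord) : Prop :=
  match g with
  | OZ => True
  | OS b => exists x, P x /\ wge (fun y => P y /\ incmp x y) b
  | OL J f => forall i, wge P (f i)
  end.

Definition wlt (P : T -> Prop) (g : Ord) : Prop := exists2 g', olt g' g & wle P g'.

Lemma wge_sub P Q g : (forall x, P x -> Q x) -> wge P g -> wge Q g.
Proof.
elim: g P Q => [|g IH|J f IH] P Q hPQ //=.
- case=> x [hx h]; exists x; split; first exact: hPQ.
  by apply: IH h => y [/hPQ].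
- by move=> h i; apply: IH (h i).
Qed.

Lemma wge_pval P g (p : pd g) : wge P g -> wge P (OS (pval p)).
Proof.
elim: g P p => [|g IH|J f IH] P /=; first by case.
- case=> [p|] [x [hx h]]; last by exists x.
  have [y [[hy _] hz]] := IH _ p h.
  by exists y; split=> //; apply: wge_sub hz => z [[]].
- by case=> i p h; apply: IH.
Qed.

Lemma wge_le P a b : ole a b -> wge P b -> wge P a.
Proof.
elim: a P b => [|a IH|J f IH] P b //=.
- case=> p hp /(@wge_pval _ _ p) [x [hx h]].
  by exists x; split=> //; apply: IH h.
- by move=> h hb i; apply: IH hb.
Qed.

Lemma wle_empty P g : (forall x, ~ P x) -> wle P g.
Proof. by move=> h; constructor=> x /h. Qed.

End SubsetWidth.

(** Only incomparability has to be preserved. A relation replaces a map because elements of the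
    product name ordinals only up to [oeq]. *)
Lemma wge_transfer T le T' le' (R : T -> T' -> Prop) P (P' : T' -> Prop) g :
  (forall x, P x -> exists x', P' x' /\ R x x') ->
  (forall x x' y y', R x x' -> R y y' -> incmp le x y -> incmp le' x' y') ->
  wge le P g -> wge le' P' g.
Proof.
move=> hP hR; elim: g P P' hP => [|g IH|J f IH] P P' hP //=.
- case=> x [/hP [x' [hx' rx]] h]; exists x'; split=> //; apply: IH h => y [/hP [y' [hy' ry]] hi].
  by exists y'; split=> //; split=> //; apply: hR hi.
- by move=> h i; apply: IH (h i).
Qed.

Lemma wle_transfer T le T' le' (R : T -> T' -> Prop) P (P' : T' -> Prop) g :
  (forall x, P x -> exists x', P' x' /\ R x x') ->
  (forall x x' y y', R x x' -> R y y' -> incmp le x y -> incmp le' x' y') ->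
  wle le' P' g -> wle le P g.
Proof.
move=> hP hR; move: P P' hP; elim/(well_founded_ind olt_wf): g => g IH P P' hP [h].
constructor=> x /hP [x' [hx' rx]]; have [g' [hg' hw]] := h _ hx'.
exists g'; split=> //; apply: (IH _ hg') hw => y [/hP [y' [hy' ry]] hi].
by exists y'; split=> //; split=> //; apply: hR hi.
Qed.

Section WidthCalculus.
Variables (T : Type) (le : T -> T -> Prop).
Implicit Types P Q B : T -> Prop.

Lemma wle_sub P Q g : (forall x, P x -> Q x) -> wle le Q g -> wle le P g.
Proof.
move=> h; apply: (@wle_transfer _ _ _ _ eq) => [x hx|x _ y _ <- <- //].
by exists x; split=> //; apply: h.
Qed.

Lemma wlt_sub P Q g : (forall x, P x -> Q x) -> wlt le Q g -> wlt le P g.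
Proof. by move=> h [g' hg hw]; exists g' => //; apply: wle_sub hw. Qed.

(** A chosen element lies in one of the two sets and lowers the bound of that one; the natural sum
    measures such interleaved descents. *)
Lemma wle_union P A B a b : wle le A a -> wle le B b ->
  (forall x, P x -> A x \/ B x) -> wle le P (onsum a b).
Proof.
move: b P A B; elim/(well_founded_ind olt_wf): a => a IHa.
elim/(well_founded_ind olt_wf) => b IHb P A B hA hB hP.
constructor=> x /hP [hx|hx].
- case: (hA) => /(_ x hx) [a' [ha' hA']].
  exists (onsum a' b); split; first exact: onsum_lt2r.
  by apply: (IHa _ ha') hA' hB _ => y [/hP [?|?] ?]; [left|right].
- case: (hB) => /(_ x hx) [b' [hb' hB']].
  exists (onsum a b'); split; first exact: onsum_lt2l.
  by apply: (IHb _ hb') hA hB' _ => y [/hP [?|?] ?]; [left|right].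
Qed.

Lemma wlt_union P A B g : nsum_closed g -> wlt le A g -> wlt le B g ->
  (forall x, P x -> A x \/ B x) -> wlt le P g.
Proof.
move=> hg [a ha hA] [b hb hB] hP; exists (onsum a b); first exact: hg.
exact: wle_union hA hB hP.
Qed.

Lemma wlt_bigunion (I : Type) (r : list I) P (A : I -> T -> Prop) g :
  nsum_closed g -> olt OZ g -> (forall i, In i r -> wlt le (A i) g) ->
  (forall x, P x -> exists2 i, In i r & A i x) -> wlt le P g.
Proof.
move=> hg g0; elim: r P => [|i r IH] P hA hP.
  by exists OZ => //; apply: wle_empty => x /hP [].
apply: (@wlt_union _ (A i) (fun x => exists2 i, In i r & A i x)) => //.
- by apply: hA; left.
- by apply: IH => // j hj; apply: hA; right.
- by move=> x /hP [j [<-|hj] hx]; [left | right; exists j].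
Qed.

(* The elements witnessing [b] are played first, those witnessing [a] afterwards. *)
Lemma wge_oadd P Q B a b :
  (forall s, (forall z, In z s -> B z) ->
     wge le (fun y => Q y /\ incomp_with le s y) a) ->
  wge le B b -> (forall y, Q y \/ B y -> P y) -> wge le P (oadd a b).
Proof.
elim: b P Q B => [|b IH|J f IH] P Q B hQ hB hP.
- apply: wge_sub (hQ nil _) => // y [hy _]; apply: hP; by left.
- case: hB => x [hx hB]; exists x; split; first by apply: hP; right.
  (* The element [x] just played restricts what is left for [a]; the hypothesis at [x :: s] shows
     that enough remains. *)
  apply: (IH _ (fun y => Q y /\ incmp le x y)) hB _; last first.
    by move=> y [|] [hy hi]; split=> //; apply: hP; [left|right].
  move=> s hs; apply: wge_sub (hQ (x :: s) _) => [y [hy hi]|z].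
    split; first by split=> //; apply: hi; left.
    by move=> z hz; apply: hi; right.
  by case=> [<- //|/hs []].
- case=> [i|] /=; first by apply: IH hP.
  apply: wge_sub (hQ nil _) => // y [hy _]; apply: hP; by left.
Qed.

Lemma wge_one P x : P x -> wge le P oone.
Proof. by move=> hx; exists x. Qed.

(** The exponent is rewritten as the supremum of the successors of its predecessors, which treats
    zero, successor and limit exponents alike; the point of [P] accounts for the value 1. *)
Lemma wge_oexpw P c : (exists x, P x) ->
  (forall c', olt c' c -> wge le P (oexpw (OS c'))) -> wge le P (oexpw c).
Proof.
move=> [x hx] h; apply: (@wge_le _ _ _ _ (oexpw (OL (fun p : pd c => OS (pval p))))).
  by apply: oexpw_mono; apply: ole_pval => p; apply: (ole_OL (i := p)); apply: ole_refl.
case=> [p|]; last exact: wge_one hx.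
by apply: h; apply: olt_pval.
Qed.

End WidthCalculus.

(** * The width as the rank of the tree of antichains *)

Section Rank.
Variables (T : Type) (le : T -> T -> Prop).
Local Notation tree := (anode le).
Local Notation res s := (incomp_with le s).

Lemma all_incomp_cat x s u :
  all_incomp le x (s ++ u)%list <-> all_incomp le x s /\ all_incomp le x u.
Proof. by elim: s => [|y s IH] /=; [tauto | rewrite IH; tauto]. Qed.

Lemma all_incompP x s : all_incomp le x s <-> forall y, In y s -> incmp le x y.
Proof.
elim: s => [|y s IH] /=; first by split.
rewrite IH; split=> [[hy hs] z [<-|/hs] //|h].
by split=> [|z hz]; apply: h; [left|right].
Qed.

Lemma antichain_cat s u : antichain le (s ++ u) <->
  antichain le s /\ antichain le u /\ forall x, In x u -> res s x.
Proof.
elim: s => [|y s IH] /=; first by split=> [h|[_ []]].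
rewrite all_incomp_cat IH !all_incompP; split.
  case=> -[h1 h2] [h3 [h4 h5]]; split=> //; split=> // x hx z [<-|hz]; first exact: h2.
  exact: h5.
case=> -[h1 h2] [h3 h4]; split; first by split=> // x hx; apply: h4 => //; left.
by split=> //; split=> // x hx z hz; apply: h4 => //; right.
Qed.

Lemma aext_inv (s t : tree) : aext s t ->
  exists x u, proj1_sig t = proj1_sig s ++ x :: u /\ res (proj1_sig s) x.
Proof.
case=> -[|x u] [] // _ e; exists x, u; split=> //.
by have [_] := proj2_sig t; rewrite e => /antichain_cat [_ [_]]; apply; left.
Qed.

Lemma res_sub s x u (y : T) : res (s ++ x :: u) y -> res s y /\ incmp le x y.
Proof.
move=> h; split=> [z hz|]; apply: h; apply/in_app_iff; [by left | by right; left].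
Qed.

(** An extension may append several elements at once, but the first of them already lowers the bound
    on the residual. *)
Lemma wle_acc g (s : tree) : wle le (res (proj1_sig s)) g ->
  Acc (fun t s => aext s t) s.
Proof.
move: s; elim/(well_founded_ind olt_wf): g => g IH s [h].
constructor=> t /aext_inv [x [u [e hx]]].
have [g' [hg' hw]] := h _ hx; apply: (IH _ hg').
by rewrite e; apply: wle_sub hw => y /res_sub.
Qed.

Lemma one_node (x : T) : [:: x] <> [::] /\ antichain le [:: x].
Proof. by []. Qed.

Lemma rcons_node (s : tree) x : res (proj1_sig s) x ->
  proj1_sig s ++ [:: x] <> [::] /\ antichain le (proj1_sig s ++ [:: x]).
Proof.
case: s => s [hs ha] /= hx; split; first by case: (s).
by apply/antichain_cat; split=> //; split=> // y [<-|[]].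
Qed.

Variable rho : tree -> Ord.
Hypothesis rhoE : forall s,
  oeq (rho s) (OL (fun t : {t : tree | aext s t} => OS (rho (proj1_sig t)))).

Lemma rank_le g (s : tree) : wle le (res (proj1_sig s)) g -> ole (rho s) g.
Proof.
move: s; elim/(well_founded_ind olt_wf): g => g IH s [h].
apply: ole_trans (proj1 (rhoE s)) _; case=> t hst; case: (aext_inv hst) => x [u [e hx]].
have [g' [hg' hw]] := h _ hx; apply: ole_lt_trans (hg') => /=.
by apply: (IH _ hg'); rewrite e; apply: wle_sub hw => y /res_sub.
Qed.

Lemma rank_ge g (s : tree) : wge le (res (proj1_sig s)) g -> ole g (rho s).
Proof.
elim: g s => [|g IH|J f IH] s //.
- case=> x [hx hw]; apply: ole_trans (proj2 (rhoE s)).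
  pose t : tree := exist _ _ (rcons_node hx).
  have hst : aext s t by exists [:: x].
  apply: (ole_OL (i := exist _ t hst)); apply: ole_OS_OS; apply: IH.
  apply: wge_sub hw => y [hy hi] z /= /in_app_iff [/hy //|[<- //|[]]].
- by move=> h i; apply: IH (h i).
Qed.

(** The empty sequence is not a node, so the first choice is made at the level of the forest, and
    the rank lemmas apply from one element on. *)
Lemma forest_rank g : wle le (fun=> True) g -> wge le (fun=> True) g ->
  oeq g (OL (fun s : tree => OS (rho s))).
Proof.
move=> [h] hg; split.
  elim: g hg {h} => [|g IH|J f IH] //.
    case=> x [_ hw]; apply: (ole_OL (i := exist _ _ (one_node x))).
    apply: ole_OS_OS; apply: rank_ge.
    by apply: wge_sub hw => y [_ hi] z /= [<- //|[]].
  by move=> hg i; apply: IH (hg i).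
move=> s; case es: (proj1_sig s) => [|x u]; first by have [] := proj2_sig s.
have [g' [hg' hw]] := h x I; apply: ole_lt_trans hg'; apply: rank_le.
rewrite es; apply: wle_sub hw => y hy; split=> //; apply: hy; by left.
Qed.

End Rank.

(** The upper bound makes extension well founded, so a rank function exists by recursion. *)
Lemma width_isI T (le : T -> T -> Prop) g :
  wle le (fun=> True) g -> wge le (fun=> True) g -> width_is le g.
Proof.
move=> h1 h2.
have wf : well_founded (fun t s : anode le => aext s t).
  move=> s; apply: (@wle_acc _ _ g); exact: wle_sub h1.
pose rho := Fix wf (fun _ => Ord) (fun s rec =>
  OL (fun t : {t : anode le | aext s t} => OS (rec (proj1_sig t) (proj2_sig t)))).
have rhoE s : oeq (rho s) (OL (fun t : {t : anode le | aext s t} => OS (rho (proj1_sig t)))).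
  rewrite {1}/rho Fix_eq; first exact: oeq_refl.
  move=> x f f' e; congr OL; apply: functional_extensionality => t.
  by congr OS; apply: e.
by exists rho; split=> //; apply: forest_rank.
Qed.

(** * Natural sums of finite families *)

Lemma olt_pd b a : olt b a -> exists p : pd a, oeq b (pval p).
Proof.
elim: a => [|a IH|J f IH] h; first by case: h => -[].
- have [hab|/IH [p hp]] := ole_or_lt a b; last by exists (Some p).
  by exists None; split=> //; apply: olt_OS_le.
- have [i /IH [p hp]] := olt_OL h; by exists (existT _ i p).
Qed.

(** Left subtraction of 1: if 1 + s <= s then d = s works; otherwise s lies below 1 + s, hence in
    its copy of s. *)
Lemma oone_add_surj s : olt OZ s -> exists d, oeq (oadd oone d) s.
Proof.
move=> s0; have [h|h] := ole_or_lt (oadd oone s) s.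
  by exists s; split=> //; apply: ole_oaddl.
have [/olt_OS_le hs|[d _ /oeq_sym hd]] := olt_oadd_inv h; last by exists d.
by case: (@olt_leF _ _ s0).
Qed.

Definition omega : Ord := oexpw oone.

Lemma omega_le_pred b : ole omega (OS b) -> ole omega b.
Proof. by move=> h k; apply: olt_OS_le; apply: (h k.+1). Qed.

(** From k <= a follows k + 1 <= 1 + k <= 1 + a <= a. *)
Lemma omega_le_absorb a : ole (oadd oone a) a -> ole omega a.
Proof.
move=> h; suff H k : ole (omul_nat oone k) a by move=> k; apply: H.
elim: k => [//|k IH]; apply: (ole_trans (b := oadd oone a)) => //.
suff H : ole (OS (omul_nat oone k)) (oadd oone (omul_nat oone k)).
  by apply: ole_trans H _; apply: ole_oadd2l.
by elim: (k) => [|l IHl]; [apply: ole_refl | apply: ole_OS_OS].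
Qed.

Section OSum.
Variable n : nat.
Implicit Types (alpha : 'I_n -> Ord) (D : pred 'I_n) (i j m : 'I_n).

Definition osum D alpha : Ord := \big[onsum/OZ]_(i < n | D i) alpha i.

Definition upd alpha i b : 'I_n -> Ord := fun j => if j == i then b else alpha j.

Lemma updE alpha i b : upd alpha i b i = b.
Proof. by rewrite /upd eqxx. Qed.

Lemma updN alpha i b j : j != i -> upd alpha i b j = alpha j.
Proof. by rewrite /upd => /negbTE ->. Qed.

Lemma upd_id alpha i : upd alpha i (alpha i) = alpha.
Proof. by apply: functional_extensionality => j; rewrite /upd; case: eqP => [->|]. Qed.

(** [onsum] is commutative and associative only up to [oeq], so the term is moved to the front by
    induction on the list. *)
Lemma big_onsumD1 D alpha i (r : list 'I_n) : uniq r -> i \in r -> D i ->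
  oeq (\big[onsum/OZ]_(j <- r | D j) alpha j)
      (onsum (alpha i) (\big[onsum/OZ]_(j <- r | D j && (j != i)) alpha j)).
Proof.
move=> ur ir Di; elim: r ur ir => // x r IH /= /andP[xr ur]; rewrite inE !big_cons.
have [ei _|ix /= ir] := eqVneq i x.
  subst x; rewrite Di /= [X in oeq _ (onsum _ X)](_ : _ = \big[onsum/OZ]_(j <- r | D j) alpha j).
    exact: oeq_refl.
  rewrite big_seq_cond [RHS]big_seq_cond; apply: eq_bigl => j.
  have [jr|] //= := boolP (j \in r).
  have -> : j != i by apply: contraNneq xr => <-.
  by rewrite andbT.
rewrite andbT; case: (D x) => //; last exact: IH.
apply: oeq_trans (onsum_eq (oeq_refl _) (IH ur ir)) _; exact: onsumCA.
Qed.

Lemma osumD1 D alpha i : D i ->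
  oeq (osum D alpha) (onsum (alpha i) (osum (fun j => D j && (j != i)) alpha)).
Proof. by move=> Di; apply: big_onsumD1 => //; rewrite ?index_enum_uniq ?mem_index_enum. Qed.

Lemma osum_ge D alpha i : D i -> ole (alpha i) (osum D alpha).
Proof. by move=> /(osumD1 alpha) [_ h]; apply: ole_trans h; apply: ole_onsuml. Qed.

Lemma osum_upd_out D alpha i b : ~~ D i -> osum D (upd alpha i b) = osum D alpha.
Proof.
move=> Di; apply: eq_bigr => j Dj; apply: updN.
by apply: contraNneq Di => <-.
Qed.

Lemma osum_upd_lt D alpha i b c : D i -> olt b c ->
  olt (osum D (upd alpha i b)) (osum D (upd alpha i c)).
Proof.
move=> Di bc; have [h1 _] := osumD1 (upd alpha i b) Di.
have [_ h2] := osumD1 (upd alpha i c) Di.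
have E d : osum (fun j => D j && (j != i)) (upd alpha i d) =
           osum (fun j => D j && (j != i)) alpha.
  by apply: osum_upd_out; rewrite eqxx andbF.
rewrite updE E in h1; rewrite updE E in h2.
by apply: ole_lt_trans h1 _; apply: olt_le_trans h2; apply: onsum_lt2r.
Qed.

Lemma osum_upd_dec D alpha i b : D i -> olt b (alpha i) ->
  olt (osum D (upd alpha i b)) (osum D alpha).
Proof. by move=> Di hb; rewrite -[X in olt _ (osum D X)](upd_id alpha i); apply: osum_upd_lt. Qed.

(** Iterates [olt_onsum_inv]: going below the sum lowers a single exponent. The lower bound
    inductions descend this way. *)
Lemma big_onsum_lt_inv D alpha (r : list 'I_n) c : uniq r ->
  olt c (\big[onsum/OZ]_(j <- r | D j) alpha j) ->
  exists i b, [/\ D i, i \in r, olt b (alpha i) &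
    ole c (\big[onsum/OZ]_(j <- r | D j) upd alpha i b j)].
Proof.
elim: r c => [|x r IH] c /=; first by rewrite big_nil => _ [[]].
case/andP=> xr ur; rewrite big_cons; case Dx: (D x); last first.
  case/(IH _ ur) => i [b [Di ir hb hc]]; exists i, b; split=> //.
    by rewrite inE ir orbT.
  by rewrite big_cons Dx.
case/olt_onsum_inv => -[d hd hc].
  exists x, d; split; rewrite ?mem_head // big_cons Dx updE.
  rewrite [X in onsum _ X](_ : _ = \big[onsum/OZ]_(j <- r | D j) alpha j) //.
  rewrite big_seq_cond [RHS]big_seq_cond; apply: eq_bigr => j /andP[jr _].
  by apply: updN; apply: contraNneq xr => <-.
have [i [b [Di ir hb hd']]] := IH _ ur hd.
exists i, b; split=> //; first by rewrite inE ir orbT.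
rewrite big_cons Dx updN; last by apply: contraNneq xr => ->.
by apply: ole_trans hc _; apply: onsum_mono hd'; apply: ole_refl.
Qed.

Lemma osum_lt_inv D alpha c : olt c (osum D alpha) ->
  exists i b, [/\ D i, olt b (alpha i) & ole c (osum D (upd alpha i b))].
Proof.
case/(big_onsum_lt_inv (index_enum_uniq _)) => i [b [Di _ hb hc]].
by exists i, b.
Qed.

Lemma osum_closed D alpha g : nsum_closed g -> olt OZ g ->
  (forall i, D i -> olt (alpha i) g) -> olt (osum D alpha) g.
Proof. by move=> hg g0 h; apply: (big_ind (fun x => olt x g)). Qed.

Lemma osum_gt0 D alpha c : olt c (osum D alpha) -> exists2 i, D i & olt OZ (alpha i).
Proof.
by case/osum_lt_inv => i [b [Di hb _]]; exists i => //; apply: ole_lt_trans hb.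
Qed.

End OSum.

(** * Boxes of ordinal tuples *)

Section Box.
Variable n : nat.
Implicit Types (alpha x y z : 'I_n -> Ord) (i j m : 'I_n).

Definition tle x y : Prop := forall i, ole (x i) (y i).

(** The product as a set of tuples of ordinals, whose coordinates can be shifted by ordinal
    arithmetic; [prodX_width] returns to [prodX]. *)
Definition box alpha : ('I_n -> Ord) -> Prop := fun y => forall i, olt (y i) (oexpw (alpha i)).

Lemma tleN x y : ~ tle x y -> exists i, olt (y i) (x i).
Proof. by move=> /not_all_ex_not [i /olt_nle h]; exists i. Qed.

Lemma box0 alpha : box alpha (fun=> OZ).
Proof. by move=> i; apply: oexpw_ge1. Qed.

Lemma box_gt0 alpha y i c : box alpha y -> olt c (y i) -> olt OZ (alpha i).
Proof.
move=> hy hc; apply: olt_nle => h; apply: (@olt_irr OZ).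
apply: ole_lt_trans (olt_le_trans hc (olt_OS_le (b := OZ) _)) => //.
exact: olt_le_trans (hy i) (oexpw_mono h).
Qed.

Lemma box_upd alpha x i b c : box alpha x -> olt c (oexpw b) ->
  box (upd alpha i b) (upd x i c).
Proof. by move=> hx hc j; rewrite /upd; case: eqP. Qed.

(** ** Upper bound *)

(** Only coordinate [m] can be nonzero, so both witnesses of incomparability fall on it and
    contradict each other. *)
Lemma wle_box_chain alpha m : (forall i, i != m -> ole (alpha i) OZ) ->
  wle tle (box alpha) oone.
Proof.
move=> h; constructor=> x hx; exists OZ; split; first exact: olt_OS.
apply: wle_empty => y [hy [/tleN [i hi] /tleN [j hj]]].
have im : i = m by apply/eqP/negPn/negP => /h /olt_leF; apply; apply: box_gt0 hx hi.
have jm : j = m by apply/eqP/negPn/negP => /h /olt_leF; apply; apply: box_gt0 hy hj.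
by subst; apply: olt_leF hi (oltW hj).
Qed.

(** Subtracting w^b * k from coordinate [i] carries the block between w^b * k and w^b * (k + 1) into
    X[i := b]; finitely many such blocks stay below the closed ordinal [g]. *)
Lemma wlt_box_blocks alpha i b k g : nsum_closed g -> olt OZ g ->
  wlt tle (box (upd alpha i b)) g ->
  wlt tle (fun y => box alpha y /\ olt (y i) (omul_nat (oexpw b) k)) g.
Proof.
move=> hg g0 [w hw hbox]; elim: k => [|k IH].
  by exists OZ => //; apply: wle_empty => y [_ [[]]].
apply: (wlt_union hg IH (B := fun y => box alpha y /\
  exists2 r, olt r (oexpw b) & oeq (y i) (oadd (omul_nat (oexpw b) k) r))); last first.
  by move=> y [hy /olt_oadd_inv [h|h]]; [left|right].
exists w => //; apply: (wle_transfer (R := fun y y' =>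
  oeq (y i) (oadd (omul_nat (oexpw b) k) (y' i)) /\ forall l, l != i -> y' l = y l)) hbox.
- move=> y [hy [r hr e]]; exists (upd y i r); split; first exact: box_upd.
  by rewrite updE; split=> // l hl; rewrite updN.
- move=> y y' z z' [ey hy] [ez hz].
  have H u u' v v' : oeq (u i) (oadd (omul_nat (oexpw b) k) (u' i)) ->
     oeq (v i) (oadd (omul_nat (oexpw b) k) (v' i)) ->
     (forall l, l != i -> u' l = u l) -> (forall l, l != i -> v' l = v l) ->
     tle u' v' -> tle u v.
    move=> [eu _] [_ ev] hu hv h l; have [->|li] := eqVneq l i.
      by apply: ole_trans eu _; apply: ole_trans ev; apply: ole_oadd2l.
    by rewrite -hu // -hv.
  by case=> h1 h2; split=> h; [apply: h1|apply: h2]; apply: H h.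
Qed.

(** Induction on alpha_m (+) d: passing to X[i := b] lowers alpha_m if i = m, and otherwise S_m and
    with it [d]. *)
Lemma wle_box alpha m d : ole (osum (predC1 m) alpha) (oadd oone d) ->
  wle tle (box alpha) (oexpw (onsum (alpha m) d)).
Proof.
move: {-2}(onsum _ _) (oeq_refl (onsum (alpha m) d)) => g.
elim/(well_founded_ind olt_wf): g alpha m d => g IH alpha m d hg hd.
have {}IH alpha' m' d' : olt (onsum (alpha' m') d') g ->
    ole (osum (predC1 m') alpha') (oadd oone d') -> wlt tle (box alpha') (oexpw g).
  move=> h1 h2; exists (oexpw (onsum (alpha' m') d')); first exact: oexpw_lt.
  by apply: IH h2 => //; apply: oeq_refl.
have g0 : olt OZ (oexpw g) by apply: oexpw_ge1.
constructor=> x hx; suff [g' ? ?] : wlt tle (fun y => box alpha y /\ incmp tle x y) (oexpw g).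
  by exists g'.
apply: (wlt_bigunion (r := enum 'I_n) (A := fun i y =>
  [/\ box alpha y, olt (y i) (x i) & exists j, olt (x j) (y j)])) => //;
  [exact: nsum_closed_oexpw | | ]; last first.
- move=> y [hy [/tleN [i hi] /tleN [j hj]]]; exists i; last by split=> //; exists j.
  suff H (r : list 'I_n) : i \in r -> In i r by apply: H; rewrite mem_enum.
  by elim: r => // a r IHr; rewrite inE => /orP[/eqP ->|/IHr]; [left|right].
move=> i _.
have [xi0|[b [k [hb hk]]]] := olt_oexpw_inv (hx i).
  exists OZ => //; apply: wle_empty => y [_ hy _]; apply: olt_leF hy _.
  exact: ole_trans xi0 _.
(* If no other exponent is positive, x_j < y_j forces j = i, against y_i < x_i. *)
have [[j ji aj]|hj] := classic (exists2 j, j != i & olt OZ (alpha j)); last first.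
  exists OZ => //; apply: wle_empty => y [hy hi [j hxj]]; apply: hj.
  exists j; last exact: box_gt0 hy hxj.
  by apply/eqP => ji; subst; apply: olt_leF hi (oltW hxj).
suff H : wlt tle (box (upd alpha i b)) (oexpw g).
  apply: wlt_sub (wlt_box_blocks k (@nsum_closed_oexpw g) g0 H) => y [hy hi _].
  by split=> //; apply: ole_lt_trans (oltW hi) hk.
have [im|im] := eqVneq i m.
  subst; apply: (IH _ m d); last by rewrite osum_upd_out //= eqxx.
  by rewrite updE; apply: olt_le_trans (proj2 hg); apply: onsum_lt2r.
have hS := olt_le_trans (osum_upd_dec (D := predC1 m) im hb) hd.
(* If the lowered sum vanishes, no 1 can be split off. The box is then a chain, and 1 < w^g since
   [j] must be [m], so that alpha_m > 0. *)
have [S0|S0] := ole_or_lt (osum (predC1 m) (upd alpha i b)) OZ.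
  exists oone; last first.
    apply: (@wle_box_chain _ m) => l lm; apply: ole_trans S0; exact: osum_ge.
  apply: (@oexpw_lt OZ).
  apply: olt_le_trans (proj2 hg); apply: olt_le_trans (ole_onsuml _ _).
  have [<- //|jm] := eqVneq j m; case: (olt_leF aj); apply: ole_trans S0.
  by rewrite -(updN alpha b ji); apply: osum_ge.
(* Here 1 + d' is the lowered sum, which is below 1 + d; hence d' < d. *)
have [d' [hd1 hd2]] := oone_add_surj S0; apply: (IH _ m d') => //.
rewrite updN 1?eq_sym //; apply: olt_le_trans (proj2 hg); apply: onsum_lt2l.
apply: olt_nle => hdd; apply: olt_leF hS _; apply: ole_trans hd1.
exact: ole_oadd2l.
Qed.

(** ** Lower bound *)

(** A positive exponent makes w^(alpha_j) a limit closed under natural sums, so a finite list is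
    bounded inside it. *)
Lemma box_above alpha j (s : list ('I_n -> Ord)) : olt OZ (alpha j) ->
  (forall z, In z s -> box alpha z) ->
  exists2 p, olt p (oexpw (alpha j)) & forall z, In z s -> olt (z j) p.
Proof.
move=> aj; elim: s => [|z s IH] hs.
  by exists OZ => //; apply: oexpw_ge1.
have [p hp hps] := IH (fun z hz => hs z (or_intror hz)).
have hz := hs z (or_introl erefl) j.
exists (OS (onsum p (z j))).
  have h := nsum_closed_oexpw hp hz.
  apply: ole_lt_trans (oadd_lt_oexpw h (oexpw_lt aj : olt oone _)).
  exact: ole_refl.
move=> y [<-|/hps hy]; apply: ole_OS_OS; first exact: ole_onsumr.
exact: ole_trans (oltW hy) (ole_onsuml _ _).
Qed.

(* The blocks [w^b * l <= y_i < w^b * (l + 1)] are played from the top one down; inside each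
   block the coordinate [j] is shifted above everything played so far, which makes the block
   incomparable to all of it. *)
Lemma wge_box_blocks alpha i j b c : i != j -> olt b (alpha i) -> olt OZ (alpha j) ->
  wge tle (box (upd alpha i b)) c -> forall k s,
  (forall z, In z s -> box alpha z /\ ole (omul_nat (oexpw b) k) (z i)) ->
  wge tle (fun y => (box alpha y /\ olt (y i) (omul_nat (oexpw b) k)) /\ incomp_with tle s y)
    (omul_nat c k).
Proof.
move=> ij hb aj hc; elim=> [//|k IH] s hs.
have [p hp hps] := box_above aj (fun z hz => proj1 (hs z hz)).
set W := oexpw b in IH hs *.
have W0 : olt OZ W by apply: oexpw_ge1.
(* [omul_nat c k.+1] is c * k + c: the top block supplies the last summand and is played first, the
   lower blocks follow. *)
apply: (wge_oadd (Q := fun y => (box alpha y /\ olt (y i) (omul_nat W k)) /\ incomp_with tle s y)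
  (B := fun y => [/\ box alpha y, ole (omul_nat W k) (y i), olt (y i) (omul_nat W k.+1)
     & ole p (y j)])).
- move=> s' hs'; apply: wge_sub (IH (s ++ s')%list _).
    move=> y [hy hi]; split; first split=> //.
      by move=> z hz; apply: hi; apply/in_app_iff; left.
    by move=> z hz; apply: hi; apply/in_app_iff; right.
  move=> z /in_app_iff [/hs [hz h]|/hs' [] //]; split=> //.
  exact: ole_trans (ole_oaddr _ _) h.
(* [f] moves a tuple into block [k] along [i] and above [p] along [j]; left cancellation makes it
   reflect the order. *)
- pose f x := upd (upd x j (oadd p (x j))) i (oadd (omul_nat W k) (x i)).
  have fi x : f x i = oadd (omul_nat W k) (x i) by rewrite /f updE.
  have fj x : f x j = oadd p (x j) by rewrite /f updN 1?eq_sym // updE.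
  have fl x l : l != i -> l != j -> f x l = x l by move=> li lj; rewrite /f !updN.
  apply: (wge_transfer (R := fun x y => y = f x)) hc => [x hx|x _ y _ -> ->].
    exists (f x); split=> //.
    have hxi : olt (x i) W by have := hx i; rewrite updE.
    have hfi : olt (f x i) (omul_nat W k.+1) by rewrite fi; apply: olt_oadd2l.
    have hxl l : l != i -> olt (x l) (oexpw (alpha l)).
      by move=> li; have := hx l; rewrite updN.
    split=> //; [|by rewrite fi; apply: ole_oaddr | by rewrite fj; apply: ole_oaddr].
    move=> l; have [->|li] := eqVneq l i.
      exact: olt_le_trans hfi (oltW (omul_oexpw_lt _ hb)).
    have [->|lj] := eqVneq l j; last by rewrite fl //; apply: hxl.
    by rewrite fj; apply: oadd_lt_oexpw => //; apply: hxl; rewrite eq_sym.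
  have H u v : tle (f u) (f v) -> tle u v.
    move=> h l; have := h l; have [->|li] := eqVneq l i; first by rewrite !fi => /ole_oadd2lE.
    have [->|lj] := eqVneq l j; first by rewrite !fj => /ole_oadd2lE.
    by rewrite !fl.
  by case=> h1 h2; split=> /H.
- move=> y [[[hy hi] hin]|[hy _ hi hj]].
    by split=> //; split=> //; apply: olt_le_trans hi _; apply: ole_oaddr.
  (* An element of the block is below z in coordinate [i] and above z in coordinate [j]. *)
  split=> // z hz; have [_ hzi] := hs z hz; split=> h.
    exact: olt_leF hi (ole_trans hzi (h i)).
  exact: olt_leF (hps z hz) (ole_trans hj (h j)).
Qed.

(** The multiples w^c * k over all [k] have supremum w^(c + 1). *)
Lemma wge_box_step alpha i j b c : i != j -> olt b (alpha i) -> olt OZ (alpha j) ->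
  wge tle (box (upd alpha i b)) (oexpw c) -> wge tle (box alpha) (oexpw (OS c)).
Proof.
move=> ij hb aj h k; apply: wge_sub (wge_box_blocks ij hb aj h (s := nil) (k := k) _) => //.
by move=> y [[]].
Qed.

Lemma oexpw_OS_mono a b : ole a b -> ole (oexpw (OS a)) (oexpw (OS b)).
Proof. by move=> h; apply: oexpw_mono; apply: ole_OS_OS. Qed.

(** Only exponents other than alpha_m are lowered, so alpha_m stays positive and serves as auxiliary
    coordinate throughout. [wge_box_lt] needs this where alpha_m would drop to 0. *)
Lemma wge_box_rest alpha m : olt OZ (alpha m) ->
  wge tle (box alpha) (oexpw (osum (predC1 m) alpha)).
Proof.
move: {2}(osum _ _) (ole_refl (osum (predC1 m) alpha)) => g.
elim/(well_founded_ind olt_wf): g alpha => g IH alpha hg am.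
apply: wge_oexpw => [|c /osum_lt_inv [i [b [im hb hc]]]]; first by exists (fun=> OZ); apply: box0.
apply: wge_le (oexpw_OS_mono hc) _; apply: (wge_box_step im hb am).
apply: IH (ole_refl _) _; last by rewrite updN // eq_sym.
exact: olt_le_trans (osum_upd_dec (D := predC1 m) im hb) hg.
Qed.

Lemma wge_box_lt alpha m e : olt OZ (alpha m) -> olt e (osum (predC1 m) alpha) ->
  wge tle (box alpha) (oexpw (onsum (alpha m) e)).
Proof.
move: {2}(onsum _ _) (ole_refl (onsum (alpha m) e)) => g.
elim/(well_founded_ind olt_wf): g alpha e => g IH alpha e hg am he.
apply: wge_oexpw => [|c hc]; first by exists (fun=> OZ); apply: box0.
case: (olt_onsum_inv hc) => -[x hx hcx].
- have [x0|x0] := ole_or_lt x OZ.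
    apply: wge_le (wge_box_rest am); apply: oexpw_mono; apply: ole_trans he.
    apply: ole_OS_OS; apply: ole_trans hcx _.
    exact: ole_trans (onsum_mono x0 (ole_refl _)) (proj1 (onsum0x e)).
  have [j jm aj] := osum_gt0 he.
  apply: wge_le (oexpw_OS_mono hcx) _; apply: (wge_box_step (i := m) (j := j) _ hx aj).
    by rewrite eq_sym.
  have := IH _ _ (upd alpha m x) e (ole_refl _).
  rewrite updE osum_upd_out /= ?eqxx //; apply=> //.
  by apply: olt_le_trans hg; apply: onsum_lt2r.
(* Some S_m[i := b] is still at least [e], so x < e remains strictly below the lowered sum. *)
- have [i [b [im hb hib]]] := osum_lt_inv he.
  apply: wge_le (oexpw_OS_mono hcx) _; apply: (wge_box_step im hb am).
  have := IH _ _ (upd alpha i b) x (ole_refl _).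
  rewrite updN 1?eq_sym //; apply=> //; last exact: olt_le_trans hx hib.
  by apply: olt_le_trans hg; apply: onsum_lt2l.
Qed.

Lemma osum_predT alpha m : oeq (osum predT alpha) (onsum (alpha m) (osum (predC1 m) alpha)).
Proof. exact: osumD1. Qed.

Lemma wge_box_infinite alpha m1 m2 : m1 != m2 ->
  ole omega (alpha m1) -> ole omega (alpha m2) ->
  wge tle (box alpha) (oexpw (osum predT alpha)).
Proof.
move: {2}(osum _ _) (ole_refl (osum predT alpha)) => g.
elim/(well_founded_ind olt_wf): g alpha => g IH alpha hg m12 h1 h2.
apply: wge_oexpw => [|c /osum_lt_inv [i [b [_ hb hc]]]]; first by exists (fun=> OZ); apply: box0.
have omega0 : olt OZ omega by apply: oexpw_ge1.
(* One of the two infinite exponents has an index other than [i] and serves as auxiliary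
   coordinate. *)
have [m mi am] : exists2 m, m != i & olt OZ (alpha m).
  have [<-|m1i] := eqVneq m1 i; last by exists m1 => //; apply: olt_le_trans h1.
  by exists m2; [rewrite eq_sym | apply: olt_le_trans h2].
apply: wge_le (oexpw_OS_mono hc) _.
(* If alpha_i <= b + 1, then [b] is infinite whenever alpha_i is, so both infinite exponents survive
   the step. *)
have [hi|hi] := ole_or_lt (alpha i) (OS b).
  apply: (wge_box_step (j := m) _ hb am); first by rewrite eq_sym.
  have H l : ole omega (alpha l) -> ole omega (upd alpha i b l).
    rewrite /upd; case: eqP => // -> h; apply: omega_le_pred; exact: ole_trans hi.
  apply: IH (ole_refl _) m12 (H _ h1) (H _ h2).
  exact: olt_le_trans (osum_upd_dec (D := predT) _ hb) hg.
(* Now T[i := b] is alpha_m (+) S_m[i := b], and S_m[i := b] < S_m[i := b + 1], so [wge_box_lt]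
   applies to X[i := b + 1]. *)
apply: wge_le (oexpw_OS_mono (proj1 (osum_predT _ m))) _.
apply: (wge_box_step (j := m) _ hi am); first by rewrite eq_sym.
rewrite updN // -(updN alpha (OS b) mi); apply: wge_box_lt; first by rewrite updN.
by apply: osum_upd_lt; [rewrite /= eq_sym | apply: olt_OS].
Qed.

End Box.

(** * Transfer to the product, and conclusion *)

Lemma prodX_width n (alpha : 'I_n -> Ord) g :
  wle (@tle n) (box alpha) g -> wge (@tle n) (box alpha) g ->
  width_is (@prodX_le n alpha) g.
Proof.
move=> h1 h2; apply: width_isI.
- apply: (wle_transfer (R := fun x y => forall i, y i = pval (x i))) h1.
    by move=> x _; exists (fun i => pval (x i)); split=> // i; apply: olt_pval.
  move=> x x' y y' rx ry [hxy hyx]; split=> h; [apply: hxy|apply: hyx] => i.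
    by rewrite -rx -ry.
  by rewrite -rx -ry.
- apply: (wge_transfer (R := fun y x => forall i, oeq (y i) (pval (x i)))) h2.
    move=> y hy; have [x hx] := fin_all_exists (fun i => olt_pd (hy i)).
    by exists x.
  move=> x x' y y' rx ry [hxy hyx]; split=> h; [apply: hxy|apply: hyx] => i.
    exact: ole_trans (proj1 (rx i)) (ole_trans (h i) (proj2 (ry i))).
  exact: ole_trans (proj1 (ry i)) (ole_trans (h i) (proj2 (rx i))).
Qed.

Theorem mainTheorem9 (n : nat) (alpha : 'I_n -> Ord)
  (n_ge1 : (1 <= n)%N)
  (alpha_dec : forall i j : 'I_n, (i <= j)%N -> ole (alpha j) (alpha i))
 :
  ((forall i : 'I_n, (0 < i)%N -> oeq (alpha i) OZ) ->
     width_is (@prodX_le n alpha) oone)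
  /\
  (~ (forall i : 'I_n, (0 < i)%N -> oeq (alpha i) OZ) ->
     let s := \big[onsum/OZ]_(i < n | (0 < i)%N) alpha i in
     (exists d : Ord, oeq (oadd oone d) s) /\
     (forall d : Ord, oeq (oadd oone d) s ->
        width_is (@prodX_le n alpha) (oexpw (onsum (alpha (Ordinal n_ge1)) d)))).
Proof.
set m := Ordinal n_ge1.
have im (i : 'I_n) : (0 < i)%N = (i != m) by rewrite -val_eqE /= lt0n.
split=> [h|h s].
  apply: prodX_width; last exact: wge_one (@box0 _ alpha).
  by apply: (@wle_box_chain _ _ m) => i; rewrite -im => /h [].
have sE : s = osum (predC1 m) alpha by apply: eq_bigl.
have s0 : olt OZ s.
  apply: olt_nle => hs; apply: h => i; rewrite im => hi; split=> //.
  by apply: ole_trans hs; rewrite sE; apply: osum_ge.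
split=> [|d [hd1 hd2]]; first exact: oone_add_surj.
have am : olt OZ (alpha m).
  move: s0; rewrite sE => /osum_gt0 [i _ hi].
  by apply: olt_le_trans hi _; apply: alpha_dec.
rewrite sE in hd1 hd2 s0.
apply: prodX_width; first exact: wle_box.
(* If d < S_m, [wge_box_lt] applies with e = d. Otherwise 1 + S_m <= 1 + d = S_m, so S_m is
   infinite. *)
have [hsd|hds] := ole_or_lt (osum (predC1 m) alpha) d; last exact: wge_box_lt.
have inf_s : ole omega (osum (predC1 m) alpha).
  by apply: omega_le_absorb; apply: ole_trans (ole_oadd2l _ hsd) hd1.
(* A natural sum of finitely many finite ordinals is finite, as omega is closed. *)
have [i hi inf_i] : exists2 i, i != m & ole omega (alpha i).
  apply: NNPP => hn; apply: olt_leF inf_s; apply: osum_closed => [||i hi].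
  - exact: nsum_closed_oexpw.
  - exact: oexpw_ge1.
  - by apply: olt_nle => ?; apply: hn; exists i.
have inf_m : ole omega (alpha m) by apply: ole_trans inf_i _; apply: alpha_dec.
(* Since d <= 1 + d = S_m, the exponent alpha_m (+) d is at most the full sum T. *)
apply: wge_le (wge_box_infinite hi inf_i inf_m); apply: oexpw_mono.
apply: ole_trans (proj2 (osum_predT alpha m)); apply: onsum_mono (ole_refl _) _.
exact: ole_trans (ole_oaddl _ _) hd1.
Qed.
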